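(* Let $S$ be a commutative unital ring and let $I$ be a quasi-maximal ideal of $S$. Then there exists a subring $R$ of $S$ such that $I=(R:S)$ and $R\subset S$ is a minimal finite extension if and only if one of the following conditions holds: (1) $I$ is inert (that is, maximal) in $S$ and the field $S/I$ has a maximal subring which is a field. (2) $I$ is decomposed in $S$, with $I=M_1\cap M_2$ where $M_1\neq M_2$ are maximal ideals of $S$, and $S/M_1\cong S/M_2$. (3) $I$ is ramified in $S$, with $M^2\subseteq I\subset M$ where $M\in \mathrm{Max}(S)$, and $\mathrm{c}(S/M)=\mathrm{c}(S/I)$. In each of these situations, $R\subset S$ is a minimal extension of the same type as the quasi-maximal ideal $I$ (inert, decomposed, ramified, respectively).
   Context: Rings are commutative and unital, subrings contain the same unit, and $\subset$ is proper inclusion; $\mathrm{c}(A)$ is the characteristic of a ring $A$. A proper ideal $I$ of a ring $S$ is quasi-maximal if for every $a\in S\setminus I$, either $I+Sa=S$ or $I+Sa$ is a maximal ideal of $S$. An ideal $I$ of $S$ is inert if it is maximal; decomposed if it is the intersection of two distinct maximal ideals; ramified if there is a maximal ideal $M$ of $S$ such that $I$ is $M$-primary, $M^2\subseteq I\subset M$ and $M=I+Sa$ for every $a\in M\setminus I$. (Quasi-maximal ideals are exactly the ideals of one of these three types.) The conductor of $R\subseteq S$ is $(R:S)=\{r\in R\mid rS\subseteq R\}$. An extension $R\subset S$ is minimal if there is no ring strictly between $R$ and $S$; finite if $S$ is a finitely generated $R$-module. A minimal finite extension $R\subset S$ satisfies $P:=(R:S)\in\mathrm{Max}(R)$ and is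 of exactly one of these types: - inert: $P\in\mathrm{Max}(S)$ and $R/P\to S/P$ is a minimal field extension; - decomposed: there exist $M_1\neq M_2$ in $\mathrm{Max}(S)$ with $P=M_1\cap M_2$ and $R/P\to S/M_1$, $R/P\to S/M_2$ isomorphisms; - ramified: there is $M'\in\mathrm{Max}(S)$ with $M'^2\subseteq P\subset M'$, $[S/P:R/P]=2$ and $R/P\to S/M'$ an isomorphism. *)

(* Defs.v *)
From HB Require Import structures.
From mathcomp Require Import all_boot all_algebra.
From mathcomp Require Import generic_quotient ring_quotient.
From mathcomp Require Import boolp.

Set Implicit Arguments.
Unset Strict Implicit.
Unset Printing Implicit Defensive.

Import GRing.Theory.
Local Open Scope ring_scope.
Local Open Scope quotient_scope.

Definition strict_subset (T : Type) (A B : {pred T}) : Prop :=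
  {subset A <= B} /\ ~ {subset B <= A}.

Definition is_field (A : comNzRingType) : Prop :=
  forall x : A, x != 0 -> exists y : A, y * x = 1.

(* The characteristic is an arbitrary natural number (e.g. 4 for Z/4Z), so the
   set [pchar A] of prime characteristics cannot be used. *)
Definition characteristic (A : nzRingType) : nat :=
  if pselect (exists n, (0 < n)%N && (n%:R == 0 :> A)) is left h
  then ex_minn h else 0%N.

Definition ring_isomorphic (A B : nzRingType) : Prop :=
  exists f : {rmorphism A -> B}, bijective f.

Section SubringType.
Variables (S : comNzRingType) (R : subringClosed S).

Record subring_type := SubringElt { subring_val : S; _ : subring_val \in R }.

HB.instance Definition _ := [isSub for subring_val].
HB.instance Definition _ := [Choice of subring_type by <:].
HB.instance Definition _ := [SubChoice_isSubComNzRing of subring_type by <:].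

End SubringType.

(* [idealr_closed] and [idealr] from ring_quotient describe proper ideals only;
   [idealr_closed M] is therefore part of the definition of a maximal ideal. *)
Section Ideals.
Variable S : comNzRingType.
Implicit Types I J M : {pred S}.

Definition maximal_ideal M : Prop :=
  idealr_closed M /\
  forall J : {pred S}, idealr_closed J -> {subset M <= J} -> J =i M.

Definition add_principal I (a : S) : {pred S} :=
  [pred z | `[< exists2 x, x \in I & exists s : S, z = x + s * a >]].

Definition ideal_prod I J : {pred S} :=
  [pred z | `[< exists2 s : seq (S * S),
                  (forall p, p \in s -> p.1 \in I /\ p.2 \in J) &
                  z = \sum_(p <- s) p.1 * p.2 >]].

Definition radical I : {pred S} := [pred x | `[< exists n, x ^+ n \in I >]].

Definition primary_ideal I : Prop :=
  idealr_closed I /\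
  forall x y : S, x * y \in I -> x \in I \/ exists n, y ^+ n \in I.

Definition primary_to M I : Prop := primary_ideal I /\ radical I =i M.

Definition quasi_maximal I : Prop :=
  idealr_closed I /\
  forall a : S, a \notin I ->
    add_principal I a =i predT \/ maximal_ideal (add_principal I a).

Definition inert_ideal I : Prop := maximal_ideal I.

Definition decomposed_by (M1 M2 I : {pred S}) : Prop :=
  [/\ maximal_ideal M1, maximal_ideal M2, ~ M1 =i M2 & I =i [predI M1 & M2]].

Definition decomposed_ideal I : Prop := exists M1 M2, decomposed_by M1 M2 I.

Definition ramified_by M I : Prop :=
  [/\ maximal_ideal M, primary_to M I, {subset ideal_prod M M <= I},
      strict_subset I M &
      forall a : S, a \in M -> a \notin I -> M =i add_principal I a].

Definition ramified_ideal I : Prop := exists M, ramified_by M I.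

End Ideals.

Section Extensions.
Variables (S : comNzRingType) (R : subringClosed S).

Definition conductor : {pred S} :=
  [pred r | (r \in R) && `[< forall s : S, r * s \in R >]].

Definition minimal_extension : Prop :=
  strict_subset R predT /\
  ~ exists T : subringClosed S, strict_subset R T /\ strict_subset T predT.

Definition finite_extension : Prop :=
  exists n (g : 'I_n -> S), forall s : S,
  exists c : 'I_n -> subring_type R, s = \sum_(i < n) val (c i) * g i.

Definition minimal_finite_extension : Prop :=
  minimal_extension /\ finite_extension.

Definition maximal_subring : Prop :=
  strict_subset R predT /\
  forall T : subringClosed S,
    {subset R <= T} -> strict_subset T predT -> T =i R.

End Extensions.

(* P /\ R as an ideal of the ring R.  When P is the conductor (R:S), which lies
   in R, this is P itself and its quotient is R/P. *)
Section Contraction.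
Variables (S : comNzRingType) (R : subringClosed S) (P : idealr S).

Definition contraction : pred (subring_type R) := fun r => val r \in P.

Lemma contraction_idealr : idealr_closed contraction.
Proof.
split.
- by rewrite unfold_in /contraction rmorph0 rpred0.
- by rewrite unfold_in /contraction rmorph1 idealr1.
move=> a u v Pu Pv; rewrite unfold_in /contraction rmorphD rmorphM.
by rewrite rpredD // idealMr.
Qed.

HB.instance Definition _ :=
  isIdealr.Build (subring_type R) contraction contraction_idealr.

Definition contraction_ideal : idealr (subring_type R) := contraction.

End Contraction.

Arguments contraction_ideal {S} R P.

Section ExtensionTypes.

(* [f] is the map R/P -> S/M induced by the inclusion of R in S. *)
Definition induced_map (S : comNzRingType) (R : subringClosed S)
    (P M : idealr S) (f : {ideal_quot contraction_ideal R P} ->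
    {ideal_quot M}) : Prop :=
  forall r : subring_type R,
    f (\pi_{ideal_quot contraction_ideal R P} r) =
    \pi_{ideal_quot M} (val r).

Definition canonical_isomorphism (S : comNzRingType) (R : subringClosed S)
    (P M : idealr S) : Prop :=
  exists f : {rmorphism {ideal_quot contraction_ideal R P} ->
                        {ideal_quot M}},
    induced_map f /\ bijective f.

Definition minimal_field_extension (A B : comNzRingType) (f : A -> B) : Prop :=
  [/\ is_field A, is_field B &
      exists K : subringClosed B,
        (forall y, y \in K <-> exists x, y = f x) /\ minimal_extension K].

Definition extension_degree (A B : comNzRingType) (f : A -> B)
    (n : nat) : Prop :=
  exists b : 'I_n -> B, forall y : B,
  exists! c : {ffun 'I_n -> A}, y = \sum_(i < n) f (c i) * b i.

Variables (S : comNzRingType) (R : subringClosed S).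

Definition inert_extension : Prop :=
  exists P : idealr S,
    [/\ P =i conductor R, maximal_ideal P &
        exists f : {rmorphism {ideal_quot contraction_ideal R P} ->
                              {ideal_quot P}},
          induced_map f /\ minimal_field_extension f].

Definition decomposed_extension : Prop :=
  exists P M1 M2 : idealr S,
    [/\ P =i conductor R, decomposed_by M1 M2 P,
        canonical_isomorphism R P M1 & canonical_isomorphism R P M2].

Definition ramified_extension : Prop :=
  exists P M : idealr S,
    [/\ P =i conductor R,
        [/\ maximal_ideal M, {subset ideal_prod M M <= P} & strict_subset P M],
        exists f : {rmorphism {ideal_quot contraction_ideal R P} ->
                              {ideal_quot P}},
          induced_map f /\ extension_degree f 2 &
        canonical_isomorphism R P M].

End ExtensionTypes.

Section Conditions.
Variables (S : comNzRingType) (I : idealr S).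

Definition inert_condition : Prop :=
  inert_ideal I /\
  exists K : subringClosed {ideal_quot I},
    maximal_subring K /\ is_field (subring_type K).

Definition decomposed_condition : Prop :=
  exists M1 M2 : idealr S,
    decomposed_by M1 M2 I /\ ring_isomorphic {ideal_quot M1} {ideal_quot M2}.

Definition ramified_condition : Prop :=
  exists M : idealr S,
    ramified_by M I /\
    characteristic {ideal_quot M} = characteristic {ideal_quot I}.

End Conditions.

(* Main.v *)
From HB Require Import structures.
Require Import Defs.
From mathcomp Require Import all_boot all_algebra.
From mathcomp Require Import generic_quotient ring_quotient.
From mathcomp Require Import boolp ring zify.
From mathcomp Require classical_sets.

(** Why the theorem holds.

    Let I = (R:S) with R in S minimal and finite.  A determinant (Nakayama)
    argument shows that I is a maximal ideal of R ([conductor_maximal]), so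
    k = R/I is a field inside S/I.  For an ideal M of S not contained in I,
    R + M is a subring strictly larger than R, hence all of S, while R and M
    meet in I if M is proper and contains I; so k maps isomorphically onto
    S/M.  Applied to the maximal ideals over a decomposed or ramified I, this
    gives S/M_1 = k = S/M_2 in the first case.  In the second case S/I
    contains a copy of its residue field k, which forces the characteristics
    to agree, and 1, a is a basis of S/I over k for any a in M outside I.  If
    I is inert, R/I is a maximal subring of the field S/I and is a field.
    Since a quasi-maximal ideal is inert, decomposed or ramified
    ([quasi_maximal_trichotomy]), one implication and the statement on types
    follow.

    Conversely R is built as the preimage of a subring of S/I.

    Inert: take the preimage of a maximal subring K that is a field.  For x
    outside K minimality gives K[x] = S/I, so 1/x is a polynomial in x, which
    is an equation of integral dependence for y = 1/x; and K[y] = S/I as well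
    ([minimal_subfield_finite]).

    Decomposed: S/I is a product of two isomorphic fields; take the graph of
    the isomorphism.

    Ramified: A = S/I is local with maximal ideal m = M/I of square zero, and
    R is the preimage of a coefficient field of A, a subring F with
    F /\ m = 0 and F + m = A ([coefficient_field_exists]).  Equality of the
    characteristics says that the prime subring of A meets m trivially, so
    Zorn's lemma provides a maximal F with F /\ m = 0; in characteristic p one
    takes F above the subring of p-th powers, which meets m trivially because
    the Frobenius map kills m.  Such an F is a field.  For x outside F let g
    over F be monic of least degree with g(x) in m; it exists since F[x] meets
    m nontrivially.  If g'(x) is a unit, one Newton step moves x by an element of m to a
    root of g, and adjoining that root keeps the intersection with m trivial.
    Otherwise g' = 0, so the characteristic is p, p divides deg g, and
    X^p - x^p can play the role of g, with x itself as root. *)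

Set Implicit Arguments.
Unset Strict Implicit.
Unset Printing Implicit Defensive.

Import GRing.Theory.
Local Open Scope ring_scope.
Local Open Scope quotient_scope.

(** * Ideals, subrings and quotients *)

Definition pack_ideal (S : comNzRingType) (M : {pred S}) (hM : idealr_closed M) :
  idealr S := HB.pack (M : S -> bool) (isIdealr.Build S M hM).

Definition pack_subring (S : comNzRingType) (T : {pred S})
    (hT : GRing.subring_closed T) : subringClosed S :=
  HB.pack (T : S -> bool) (GRing.isSubringClosed.Build S T hT).

Lemma idealr_is_closed (S : comNzRingType) (M : idealr S) : idealr_closed M.
Proof.
split; [exact: rpred0 | by rewrite idealr1 |].
by move=> a u v Mu Mv; rewrite rpredD // idealMr.
Qed.

Lemma subset_witness (T : eqType) (A B : {pred T}) :
  ~ {subset A <= B} -> exists2 x, x \in A & x \notin B.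
Proof.
move=> nAB; apply: contrapT => h; apply: nAB => x Ax.
by apply: contrapT => /negP nBx; apply: h; exists x.
Qed.

Lemma rmorph_image_closed (A B : comNzRingType) (f : {rmorphism A -> B}) :
  GRing.subring_closed [pred y | `[< exists x, y = f x >]].
Proof.
split; first by apply/asboolP; exists 1; rewrite rmorph1.
- move=> _ _ /asboolP[x ->] /asboolP[y ->]; apply/asboolP.
  by exists (x - y); rewrite rmorphB.
- move=> _ _ /asboolP[x ->] /asboolP[y ->]; apply/asboolP.
  by exists (x * y); rewrite rmorphM.
Qed.

Definition rmorph_image (A B : comNzRingType) (f : {rmorphism A -> B}) :=
  pack_subring (rmorph_image_closed f).

Lemma rmorph_imageP (A B : comNzRingType) (f : {rmorphism A -> B}) y :
  reflect (exists x, y = f x) (y \in rmorph_image f).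
Proof. exact: asboolP. Qed.

Lemma preimage_subring_closed (A B : comNzRingType) (f : {rmorphism A -> B})
  (K : subringClosed B) : GRing.subring_closed [pred x | f x \in K].
Proof.
split; first by rewrite inE rmorph1 rpred1.
- by move=> x y; rewrite !inE rmorphB; apply: rpredB.
- by move=> x y; rewrite !inE rmorphM; apply: rpredM.
Qed.

Definition preimage_subring (A B : comNzRingType) (f : {rmorphism A -> B})
  (K : subringClosed B) := pack_subring (preimage_subring_closed f K).

Lemma mem_preimage_subring (A B : comNzRingType) (f : {rmorphism A -> B})
  (K : subringClosed B) x : (x \in preimage_subring f K) = (f x \in K).
Proof. by []. Qed.

Lemma pi_eqP (S : comNzRingType) (I : idealr S) (x y : S) :
  reflect (\pi x = \pi y :> {ideal_quot I}) (x - y \in I).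
Proof. rewrite Quotient.idealrBE; exact: eqP. Qed.

Lemma pi_eq0 (S : comNzRingType) (I : idealr S) (x : S) :
  (\pi x == 0 :> {ideal_quot I}) = (x \in I).
Proof. by rewrite -[in RHS](subr0 x) Quotient.idealrBE (rmorph0 (\pi_{ideal_quot I})). Qed.

Lemma pi_surj (S : comNzRingType) (I : idealr S) (q : {ideal_quot I}) :
  exists x : S, q = \pi x.
Proof. by exists (repr q); rewrite reprK. Qed.

Lemma quot_lift (A B : comNzRingType) (P : idealr A) (phi : {rmorphism A -> B}) :
  (forall x, x \in P -> phi x = 0) ->
  exists f : {rmorphism {ideal_quot P} -> B}, forall x, f (\pi x) = phi x.
Proof.
move=> phiP; pose f0 (q : {ideal_quot P}) : B := phi (repr q).
have f0E x : f0 (\pi x) = phi x.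
  apply/eqP; rewrite -subr_eq0 -rmorphB; apply/eqP/phiP.
  by apply/pi_eqP; rewrite reprK.
have f0B : zmod_morphism f0.
  move=> p q; have [x ->] := pi_surj p; have [y ->] := pi_surj q.
  by rewrite -rmorphB !f0E rmorphB.
have f0M : monoid_morphism f0.
  split; first by rewrite -[1](rmorph1 (\pi_{ideal_quot P})) f0E rmorph1.
  move=> p q; have [x ->] := pi_surj p; have [y ->] := pi_surj q.
  by rewrite -rmorphM !f0E rmorphM.
pose f : {rmorphism {ideal_quot P} -> B} :=
  HB.pack f0 (GRing.isZmodMorphism.Build _ _ f0 f0B)
             (GRing.isMonoidMorphism.Build _ _ f0 f0M).
by exists f.
Qed.

Lemma add_principalP (S : comNzRingType) (I : {pred S}) (a z : S) :
  reflect (exists2 x, x \in I & exists s : S, z = x + s * a) (z \in add_principal I a).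
Proof. exact: asboolP. Qed.

Lemma mem_add_principal (S : comNzRingType) (I : idealr S) (a : S) :
  a \in add_principal I a.
Proof. by apply/add_principalP; exists 0; rewrite ?rpred0 //; exists 1; rewrite mul1r add0r. Qed.

Lemma sub_add_principal (S : comNzRingType) (I : idealr S) (a : S) :
  {subset I <= add_principal I a}.
Proof. by move=> x Ix; apply/add_principalP; exists x => //; exists 0; rewrite mul0r addr0. Qed.

Lemma add_principal_closed (S : comNzRingType) (I : idealr S) (a : S) :
  1 \notin add_principal I a -> idealr_closed (add_principal I a).
Proof.
move=> n1; split=> //.
  by apply/asboolP; exists 0; rewrite ?rpred0 //; exists 0; rewrite mul0r addr0.
move=> c u v /asboolP[x Ix [s ->]] /asboolP[y Iy [t ->]]; apply/asboolP.
exists (c * x + y); first by rewrite rpredD // idealMr.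
by exists (c * s + t); rewrite mulrDl mulrDr mulrA addrACA.
Qed.

Lemma maximal_idealP (S : comNzRingType) (M : idealr S) :
  maximal_ideal M <-> forall x, x \notin M -> exists y, 1 - y * x \in M.
Proof.
split=> [[_ maxM] x xM | invM].
  have [/asboolP[m Mm [s e]]|n1] := boolP (1 \in add_principal M x).
    by exists s; rewrite e addrK.
  have sub : {subset M <= add_principal M x}.
    by move=> m Mm; apply/asboolP; exists m => //; exists 0; rewrite mul0r addr0.
  case/negP: xM; rewrite -(maxM _ (add_principal_closed n1) sub).
  by apply/asboolP; exists 0; rewrite ?rpred0 //; exists 1; rewrite mul1r add0r.
split; first exact: idealr_is_closed.
move=> J hJ MJ x; apply/idP/idP => [Jx|]; last exact: MJ.
apply: contraT => /invM[y My].
have : 1 \in pack_ideal hJ.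
  rewrite -[1](subrK (y * x)) rpredD //; last exact: idealMr.
  exact: MJ.
by rewrite idealr1.
Qed.

Lemma maximal_sub_eq (S : comNzRingType) (M J : idealr S) :
  maximal_ideal M -> {subset M <= J} -> J =i M.
Proof.
by move=> [_ h] MJ; apply: h => //; exact: idealr_is_closed.
Qed.

(** * Quasi-maximal ideals *)

(** Above a non-maximal I there is a maximal ideal M of the form I + Sa.  If
    some other I + Sb is proper, it is a second maximal ideal N, and any x in
    both M and N but outside I would make I + Sx a maximal ideal contained in
    both.  Otherwise every I + Sb is I, M or S, so S/I is local with M/I
    simple, and M^2 lies in I because 1 - sy is a unit modulo I for y in M. *)
Lemma quasi_maximal_trichotomy (S : comNzRingType) (I : idealr S) :
  quasi_maximal I -> [\/ inert_ideal I, decomposed_ideal I | ramified_ideal I].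
Proof.
move=> [_ qI]; have [|nmaxI] := pselect (maximal_ideal I); first by constructor 1.
have [a nIa naT] : exists2 a, a \notin I & ~ add_principal I a =i predT.
  apply: contrapT => nex; apply: nmaxI; apply/maximal_idealP => x nIx.
  have [aT|naT] := pselect (add_principal I x =i predT); last by case: nex; exists x.
  have /add_principalP[i Ii [s e]] : 1 \in add_principal I x by rewrite aT.
  by exists s; rewrite e addrK.
have [//|maxIa] := qI a nIa.
pose M := pack_ideal maxIa.1.
have maxM : maximal_ideal M by [].
have IM : {subset I <= M} by exact: sub_add_principal.
have Ma : a \in M by exact: mem_add_principal.
have [[b nIb [nbT nMb]]|all_M] := pselect (exists2 b, b \notin I &
  ~ add_principal I b =i predT /\ ~ add_principal I b =i M).
  constructor 2; have [//|maxN] := qI b nIb.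
  exists (M : {pred S}), (add_principal I b); split=> //; first by move=> e; apply: nMb => x.
  pose N := pack_ideal maxN.1.
  move=> x; apply/idP/andP => [Ix|[Mx Nx]].
    by split; [exact: IM | exact: sub_add_principal].
  apply: contraT => nIx.
  have xN : {subset add_principal I x <= N}.
    move=> _ /add_principalP[i Ii [s ->]].
    by rewrite rpredD ?idealMr //; exact: sub_add_principal.
  have xM : {subset add_principal I x <= M}.
    by move=> _ /add_principalP[i Ii [s ->]]; rewrite rpredD ?idealMr //; exact: IM.
  have [xT|maxJ] := qI x nIx.
    have : 1 \in N by apply: xN; rewrite xT.
    by rewrite idealr1.
  pose J := pack_ideal maxJ.1.
  case: nMb => y.
  have := @maximal_sub_eq _ J N maxJ xN y.
  by have := @maximal_sub_eq _ J M maxJ xM y => -> ->.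
have nIM b : b \notin I -> b \in M -> add_principal I b =i M.
  move=> nIb Mb; apply: contrapT => neq; apply: all_M; exists b => //; split=> // bT.
  have : 1 \in add_principal I b by rewrite bT.
  case/add_principalP=> i Ii [s e]; have : 1 \in M by rewrite e rpredD ?idealMr // IM.
  by rewrite idealr1.
have nM b : b \notin M -> exists s, 1 - s * b \in I.
  move=> nMb; have nIb : b \notin I by apply: contra nMb; exact: IM.
  have [bT|ne] := pselect (add_principal I b =i predT).
    have : 1 \in add_principal I b by rewrite bT.
    by case/add_principalP=> i Ii [s ->]; exists s; rewrite addrK.
  case: all_M; exists b => //; split=> // e.
  by case/negP: nMb; rewrite -e mem_add_principal.
have MM x y : x \in M -> y \in M -> x * y \in I.
  move=> Mx My; apply: contraT => nxy.
  have Mxy : x * y \in M by rewrite idealMr.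
  have : x \in add_principal I (x * y) by rewrite nIM.
  case/add_principalP=> i Ii [s e].
  have /nM[t It] : 1 - s * y \notin M.
    apply/negP => h; have : 1 \in M by rewrite -(subrK (s * y) 1) rpredD // idealMr.
    by rewrite idealr1.
  have Ix : x \in I.
    have -> : x = x * (1 - t * (1 - s * y)) + t * i.
      have -> : i = x - s * (x * y) by rewrite {1}e addrK.
      ring.
    by rewrite rpredD // idealMr.
  by case/negP: nxy; rewrite mulrC idealMr.
have nrad y n : y \notin M -> y ^+ n \notin M.
  have [_ invM] := maximal_idealP M => nMy.
  have [s Is] := nM y nMy.
  elim: n => [|n IH]; first by rewrite expr0 idealr1.
  apply: contra IH => h.
  have -> : y ^+ n = y ^+ n * (1 - s * y) + s * y ^+ n.+1 by rewrite exprS; ring.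
  by rewrite rpredD // idealMr // IM.
constructor 3; exists (M : {pred S}); split=> //.
- split; last first.
    move=> x; apply/asboolP/idP => [[n /IM]|Mx]; last first.
      by exists 2; rewrite expr2 MM.
    by apply: contraLR => /nrad.
  split; first exact: idealr_is_closed.
  move=> x y Ixy; have [My|/nM[s Is]] := boolP (y \in M).
    by right; exists 2; rewrite expr2 MM.
  left; have -> : x = x * (1 - s * y) + s * (x * y) by ring.
  by rewrite rpredD // idealMr.
- move=> _ /asboolP[s sM ->]; rewrite big_seq; apply: rpred_sum => p /sM[M1 M2].
  exact: MM.
- by split=> // MI; case/negP: nIa; exact: MI.
- by move=> b Mb nIb x; rewrite nIM.
Qed.

(** * The conductor of a minimal finite extension *)

Section Conductor.
Variables (S : comNzRingType) (R : subringClosed S).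

Lemma ideal_sub_conductor (J : idealr S) : {subset J <= R} -> {subset J <= conductor R}.
Proof.
move=> JR x Jx; apply/andP; split; first exact: JR.
by apply/asboolP => s; rewrite mulrC; apply: JR; rewrite idealMr.
Qed.

Lemma minimal_extension_above (T : subringClosed S) :
  minimal_extension R -> {subset R <= T} -> ~ {subset T <= R} -> forall s, s \in T.
Proof.
move=> [_ minR] RT TR s; apply: contrapT => nTs; apply: minR; exists T; split=> //.
by split=> // h; exact/nTs/h.
Qed.

Lemma add_ideal_closed (J : idealr S) :
  GRing.subring_closed [pred z | `[< exists2 r, r \in R & z - r \in J >]].
Proof.
split; first by apply/asboolP; exists 1; rewrite ?rpred1 // subrr rpred0.
- move=> x y /asboolP[r Rr Jr] /asboolP[t Rt Jt]; apply/asboolP.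
  exists (r - t); first exact: rpredB.
  have -> : x - y - (r - t) = (x - r) - (y - t) by ring.
  exact: rpredB.
- move=> x y /asboolP[r Rr Jr] /asboolP[t Rt Jt]; apply/asboolP.
  exists (r * t); first exact: rpredM.
  have -> : x * y - r * t = y * (x - r) + r * (y - t) by ring.
  by rewrite rpredD // idealMr.
Qed.

(** R + J is a subring of S, and it reduces to R only if J lies in R, that
    is in the conductor. *)
Lemma minimal_extension_add_ideal (J : idealr S) :
  minimal_extension R -> ~ {subset J <= conductor R} ->
  forall s, exists2 r, r \in R & s - r \in J.
Proof.
move=> minR JC s; apply/asboolP.
apply: (@minimal_extension_above (pack_subring (add_ideal_closed J))) => //.
  by move=> r Rr; apply/asboolP; exists r; rewrite ?subrr ?rpred0.
move=> TR; apply/JC/ideal_sub_conductor => x Jx; apply: TR.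
by apply/asboolP; exists 0; rewrite ?rpred0 ?subr0.
Qed.

Lemma add_mul_closed x : x \in R ->
  GRing.subring_closed [pred z | `[< exists2 r, r \in R & exists s, z = r + x * s >]].
Proof.
move=> Rx; split.
- by apply/asboolP; exists 1; rewrite ?rpred1 //; exists 0; rewrite mulr0 addr0.
- move=> _ _ /asboolP[r Rr [s ->]] /asboolP[t Rt [u ->]]; apply/asboolP.
  by exists (r - t); [exact: rpredB | exists (s - u); ring].
- move=> _ _ /asboolP[r Rr [s ->]] /asboolP[t Rt [u ->]]; apply/asboolP.
  by exists (r * t); [exact: rpredM | exists (r * u + s * t + x * s * u); ring].
Qed.

(** As for ideals, with the subring R + xS: it reduces to R only if x lies
    in the conductor. *)
Lemma minimal_extension_add_mul x : minimal_extension R -> x \in R ->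
  x \notin conductor R -> forall s, exists2 r, r \in R & exists t, s = r + x * t.
Proof.
move=> minR Rx Cx s; apply/asboolP.
apply: (@minimal_extension_above (pack_subring (add_mul_closed Rx))) => //.
  by move=> r Rr; apply/asboolP; exists r => //; exists 0; rewrite mulr0 addr0.
move=> TR; case/negP: Cx; rewrite inE /= Rx; apply/asboolP => t; apply: TR.
by apply/asboolP; exists 0; rewrite ?rpred0 //; exists t; rewrite add0r.
Qed.

(** The determinant of 1 - X C is a polynomial in X with value 1 at 0. *)
Lemma det_one_sub_scale (B : comNzRingType) n (x : B) (C : 'M[B]_n) :
  exists j, \det (1%:M - x *: C) = 1 - x * j.
Proof.
pose p : {poly B} := \det (1%:M - 'X *: map_mx polyC C).
have pE y : p.[y] = \det (1%:M - y *: C).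
  rewrite -horner_evalE -det_map_mx; congr (\det _); apply/matrixP => i j.
  rewrite !mxE /= horner_evalE !hornerE; congr (_ - _).
  by rewrite hornerMn hornerC.
have : root (p - 1) 0.
  by rewrite /root !hornerE pE scale0r subr0 det1 subrr.
case/factor_theorem=> q e; exists (- q.[x]).
have : (p - 1).[x] = (q * ('X - 0%:P)).[x] by rewrite -e.
rewrite !hornerE pE => /(canRL (subrK _)) ->; ring.
Qed.

(** Nakayama's lemma for S/R.  For x outside the conductor S = R + xS, so
    generators g of S satisfy g = r + x C g with r and C over R.  Multiplying
    (1 - x C) g = r by the adjugate shows that det (1 - x C), which is
    1 - x j for some j in R, maps S into R. *)
Lemma conductor_maximal : minimal_finite_extension R ->
  forall x, x \in R -> x \notin conductor R ->
  exists2 y, y \in R & 1 - y * x \in conductor R.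
Proof.
move=> [minR [n [g gen]]] x Rx nCx.
have xS := minimal_extension_add_mul minR Rx nCx.
have /choice[c cP] : forall i : 'I_n, exists c : 'I_n -> subring_type R,
    g i - x * \sum_(j < n) val (c j) * g j \in R.
  move=> i; have [r Rr [t ->]] := xS (g i); have [c ->] := gen t.
  by exists c; rewrite addrK.
pose x' := SubringElt Rx.
pose C : 'M[subring_type R]_n := \matrix_(i, j) c i j.
have [j detE] := det_one_sub_scale x' C.
exists (val j); first exact: (valP j).
have RM : val (\det (1%:M - x' *: C)) = 1 - val j * x.
  by rewrite detE rmorphB rmorph1 rmorphM mulrC.
pose A := map_mx val (1%:M - x' *: C).
pose G : 'cV[S]_n := \col_i g i.
have AG i k : (A *m G) i k \in R.
  rewrite /A map_mxB map_mx1 mulmxBl mul1mx !mxE.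
  rewrite (_ : \sum_j _ = x * \sum_(j < n) val (c i j) * g j) ?cP //.
  rewrite mulr_sumr; apply: eq_bigr => l _; rewrite !mxE.
  rewrite mulrA; congr (_ * _); exact: (rmorphM (\val : {rmorphism subring_type R -> S})).
have dG i : val (\det (1%:M - x' *: C)) * g i \in R.
  have -> : val (\det (1%:M - x' *: C)) * g i = (\adj A *m (A *m G)) i 0.
    by rewrite mulmxA mul_adj_mx det_map_mx mul_scalar_mx !mxE.
  rewrite !mxE; apply: rpred_sum => l _; apply: rpredM; last exact: AG.
  by rewrite -map_mx_adj !mxE; exact: valP.
rewrite -RM; apply/andP; split; first exact: valP.
apply/asboolP => s; have [d ->] := gen s; rewrite mulr_sumr; apply: rpred_sum => i _.
by rewrite mulrCA rpredM //; exact: valP.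
Qed.

Lemma finite_extensionI n (g : 'I_n -> S) :
  (forall s, exists2 c : 'I_n -> S, forall i, c i \in R & s = \sum_(i < n) c i * g i) ->
  finite_extension R.
Proof.
move=> gen; exists n, g => s; have [c Rc ->] := gen s.
by exists (fun i => SubringElt (Rc i)).
Qed.

Lemma finite_extension_pair (a : S) :
  (forall s, exists2 r, r \in R & exists2 t, t \in R & s = r + t * a) ->
  finite_extension R.
Proof.
move=> gen; apply: (@finite_extensionI 2 (fun i => if i == 0 then 1 else a)) => s.
have [r Rr [t Rt ->]] := gen s; exists (fun i : 'I_2 => if i == 0 then r else t).
  by move=> i; case: ifP.
by rewrite big_ord_recl big_ord1 /= mulr1.
Qed.

Lemma conductor_eq (I : idealr S) : {subset I <= R} ->
  (forall r, r \in R -> r \notin I -> exists s, r * s \notin R) -> I =i conductor R.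
Proof.
move=> IR nI x; apply/idP/idP; first exact: ideal_sub_conductor.
move=> /andP[Rx /asboolP h]; apply: contraT => /(nI _ Rx)[s].
by rewrite h.
Qed.

End Conductor.

(** * Characteristics, quotients and induced maps *)

Definition incl (S : comNzRingType) (R : subringClosed S) :
  {rmorphism subring_type R -> S} := \val.

Lemma characteristicP (A : nzRingType) n :
  (n%:R == 0 :> A) = (characteristic A %| n)%N.
Proof.
rewrite /characteristic; case: pselect => [h|nh]; last first.
  rewrite dvd0n; case: n => [|n]; first by rewrite mulr0n !eqxx.
  by apply/negbTE/negP => e; apply: nh; exists n.+1.
case: ex_minnP => c /andP[c0 /eqP ec] minc; apply/eqP/idP => [en|/dvdnP[k ->]]; last first.
  by rewrite natrM ec mulr0.
rewrite /dvdn; apply: contraTT (ltn_pmod n c0); rewrite -lt0n -leqNgt => r0.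
apply: minc; rewrite r0 /=.
by move: en; rewrite {1}(divn_eq n c) natrD natrM ec mulr0 add0r => ->.
Qed.

Lemma eq_characteristicP (A B : nzRingType) :
  characteristic A = characteristic B <->
  forall n, (n%:R == 0 :> A) = (n%:R == 0 :> B).
Proof.
split=> [e n|e]; first by rewrite !characteristicP e.
apply/eqP; rewrite eqn_dvd -(characteristicP A) e characteristicP dvdnn.
by rewrite -(characteristicP B) -e characteristicP dvdnn.
Qed.

(** The second hypothesis says that R is the preimage of K; it then contains
    the kernel of f, and the rings above R correspond to those above K. *)
Lemma minimal_extension_surj (A B : comNzRingType) (f : {rmorphism A -> B})
  (R : subringClosed A) (K : subringClosed B) :
  (forall y, exists x, y = f x) -> (forall x, (f x \in K) = (x \in R)) ->
  minimal_extension R <-> minimal_extension K.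
Proof.
move=> fS RK; split=> [[[_ nR] minR]|[[_ nK] minK]]; split.
- by split=> // KT; apply: nR => x _; rewrite -RK; exact: KT.
- move=> [T [[KT TK] [_ nT]]]; apply: minR; exists (preimage_subring f T).
  split; split=> //.
  + by move=> x Rx; rewrite mem_preimage_subring KT // RK.
  + move=> TR; apply: TK => y; have [x ->] := fS y => Tx.
    by rewrite RK; exact: TR.
  + by move=> AT; apply: nT => y _; have [x ->] := fS y; exact: (AT x isT).
- by split=> // RT; apply: nK => y _; have [x ->] := fS y; rewrite RK RT.
- move=> [T [[RT TR] [_ nT]]]; apply: minK.
  pose U := rmorph_image (f \o incl T).
  have TU x : (f x \in U) = (x \in T).
    apply/rmorph_imageP/idP => [[t ft]|Tx]; last by exists (SubringElt Tx).
    rewrite -(subrK (val t) x) rpredD //; last exact: valP.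
    by apply: RT; rewrite -RK rmorphB ft subrr rpred0.
  exists U; split; split=> //.
  + by move=> y; have [x ->] := fS y; rewrite RK TU; exact: RT.
  + by move=> UK; apply: TR => x; rewrite -TU -RK; exact: UK.
  + by move=> UB; apply: nT => x _; rewrite -TU UB.
Qed.

Lemma maximal_subringE (S : comNzRingType) (R : subringClosed S) :
  maximal_subring R <-> minimal_extension R.
Proof.
split=> [[pR maxR]|[pR minR]]; split=> //.
  move=> [T [[RT TR] pT]]; apply: TR => x.
  by rewrite (maxR T RT pT).
move=> T RT pT x; apply/idP/idP; last exact: RT.
apply: contraTT => nRx; apply/negP => Tx; apply: minR; exists T; split=> //.
by split=> // TR; case/negP: nRx; exact: TR.
Qed.

Lemma induced_map_exists (S : comNzRingType) (R : subringClosed S) (P M : idealr S) :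
  {subset P <= M} ->
  exists f : {rmorphism {ideal_quot contraction_ideal R P} -> {ideal_quot M}},
    induced_map f.
Proof.
move=> PM.
have [|f fE] := @quot_lift _ _ (contraction_ideal R P)
  (\pi_{ideal_quot M} \o incl R : {rmorphism subring_type R -> {ideal_quot M}}).
  by move=> x Px; apply/eqP; rewrite /= pi_eq0; exact: PM.
by exists f.
Qed.

Lemma canonical_isomorphismI (S : comNzRingType) (R : subringClosed S) (P M : idealr S) :
  {subset P <= M} -> (forall r, r \in R -> r \in M -> r \in P) ->
  (forall s, exists2 r, r \in R & s - r \in M) -> canonical_isomorphism R P M.
Proof.
move=> PM RMP RM; have [f fE] := induced_map_exists R PM; exists f; split=> //.
have finj : injective f.
  move=> q q'; have [x ->] := pi_surj q; have [y ->] := pi_surj q'.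
  rewrite !fE => /pi_eqP h; apply/pi_eqP.
  by apply: RMP; [exact: valP | exact: h].
have fsurj y : exists x, f x = y.
  have [s ->] := pi_surj y; have [r Rr Msr] := RM s.
  by exists (\pi_{ideal_quot contraction_ideal R P} (SubringElt Rr)); rewrite fE; apply/esym/pi_eqP.
have [g gE] := choice fsurj.
by exists g => // x; apply: finj.
Qed.

Lemma bijective_inverse (A B : comNzRingType) (f : {rmorphism A -> B}) :
  bijective f -> exists g : {rmorphism B -> A}, cancel f g /\ cancel g f.
Proof.
move=> [g fK gK].
have gB : zmod_morphism g by move=> x y; apply: (can_inj fK); rewrite rmorphB !gK.
have gM : monoid_morphism g.
  split; first by apply: (can_inj fK); rewrite gK rmorph1.
  by move=> x y; apply: (can_inj fK); rewrite rmorphM !gK.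
pose g' : {rmorphism B -> A} := HB.pack g (GRing.isZmodMorphism.Build _ _ g gB)
             (GRing.isMonoidMorphism.Build _ _ g gM).
by exists g'.
Qed.

Lemma maximal_quotient_is_field (S : comNzRingType) (M : idealr S) :
  maximal_ideal M -> is_field {ideal_quot M}.
Proof.
move=> maxM q; have [x ->] := pi_surj q; rewrite pi_eq0 => nMx.
have [invM _] := maximal_idealP M; have [y My] := invM maxM x nMx.
exists (\pi y); rewrite -rmorphM -(rmorph1 (\pi_{ideal_quot M})).
by apply/esym/pi_eqP.
Qed.

(** * From an extension to the type of its conductor *)

Section ConductorType.
Variables (S : comNzRingType) (I : idealr S) (R : subringClosed S).
Hypotheses (IR : I =i conductor R) (mR : minimal_finite_extension R).

Lemma conductor_ideal_sub : {subset I <= R}.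
Proof. by move=> x; rewrite IR => /andP[]. Qed.

Lemma conductor_inverse x : x \in R -> x \notin I ->
  exists2 y, y \in R & 1 - y * x \in I.
Proof.
by rewrite IR => Rx nx; have [y Ry Cy] := conductor_maximal mR Rx nx; exists y; rewrite ?IR.
Qed.

(** I is maximal in R, so a proper ideal of S above I cannot meet R in
    anything larger. *)
Lemma conductor_contraction (M : idealr S) : {subset I <= M} ->
  forall r, r \in R -> r \in M -> r \in I.
Proof.
move=> IM r Rr Mr; apply: contraT => /(conductor_inverse Rr)[y _ /IM h].
have : 1 \in M by rewrite -(subrK (y * r) 1) rpredD // idealMr.
by rewrite idealr1.
Qed.

Lemma conductor_add_ideal (M : idealr S) : ~ {subset M <= I} ->
  forall s, exists2 r, r \in R & s - r \in M.
Proof.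
move=> nMI; apply: minimal_extension_add_ideal; first exact: mR.1.
by move=> MC; apply: nMI => x /MC; rewrite IR.
Qed.

Lemma conductor_canonical_isomorphism (M : idealr S) :
  {subset I <= M} -> ~ {subset M <= I} -> canonical_isomorphism R I M.
Proof.
move=> IM nMI; apply: canonical_isomorphismI => //.
- exact: conductor_contraction.
- exact: conductor_add_ideal.
Qed.

(** The image K of R in S/I is R/I; the rings between K and S/I lift to rings
    between R and S, and inverses in K come from maximality of I in R. *)
Lemma conductor_inert : inert_ideal I -> inert_condition I /\ inert_extension R.
Proof.
move=> maxI; have fieldI := maximal_quotient_is_field maxI.
pose K := rmorph_image (\pi_{ideal_quot I} \o incl R).
have KR x : (\pi x \in K) = (x \in R).
  apply/rmorph_imageP/idP => [[r /pi_eqP e]|Rx]; last by exists (SubringElt Rx).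
  by rewrite -(subrK (val r) x) rpredD //; [exact: conductor_ideal_sub | exact: valP].
have minK : minimal_extension K.
  by apply/(minimal_extension_surj (@pi_surj _ I) KR); exact: mR.1.
split.
  split=> //; exists K; split; first exact/maximal_subringE.
  move=> x nx; have [r e] := rmorph_imageP _ _ (valP x).
  have nIr : val r \notin I.
    by apply: contra nx => Ir; rewrite -val_eqE /= e /= pi_eq0.
  have [y Ry Iy] := conductor_inverse (valP r) nIr.
  have Ky : \pi y \in K by rewrite KR.
  exists (SubringElt Ky); apply: val_inj; rewrite /= e /=.
  rewrite -rmorphM -(rmorph1 (\pi_{ideal_quot I})).
  by apply/esym/pi_eqP.
exists I; split=> //; have [f fE] := @induced_map_exists _ R I I (fun=> id).
exists f; split=> //; split=> //.
  move=> q; have [r ->] := pi_surj q; rewrite pi_eq0 => nr.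
  have [y Ry Iy] := conductor_inverse (valP r) nr.
  pose piR := \pi_{ideal_quot contraction_ideal R I}.
  exists (piR (SubringElt Ry)); rewrite -rmorphM -(rmorph1 piR).
  by apply/esym/pi_eqP.
exists K; split=> // y; split=> [/rmorph_imageP[r ->]|[q ->]].
  by exists (\pi r); rewrite fE.
by have [r ->] := pi_surj q; apply/rmorph_imageP; exists r; rewrite fE.
Qed.

(** Neither maximal ideal is contained in I, so both residue fields are
    identified with R/I. *)
Lemma conductor_decomposed : decomposed_ideal I ->
  decomposed_condition I /\ decomposed_extension R.
Proof.
move=> [M1 [M2 dI]]; have [max1 max2 ne IE] := dI.
pose N1 := pack_ideal max1.1; pose N2 := pack_ideal max2.1.
have I1 : {subset I <= N1} by move=> x; rewrite IE => /andP[].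
have I2 : {subset I <= N2} by move=> x; rewrite IE => /andP[].
have iso1 : canonical_isomorphism R I N1.
  apply: conductor_canonical_isomorphism => // h; apply: ne => x.
  have h12 : {subset N1 <= N2} by move=> y /h /I2.
  exact: esym (@maximal_sub_eq _ N1 N2 max1 h12 x).
have iso2 : canonical_isomorphism R I N2.
  apply: conductor_canonical_isomorphism => // h; apply: ne => x.
  have h21 : {subset N2 <= N1} by move=> y /h /I1.
  exact: (@maximal_sub_eq _ N2 N1 max2 h21 x).
split; last by exists I, N1, N2; split.
have [[f1 [_ bij1]] [f2 [_ bij2]]] := (iso1, iso2).
have [g [fK gK]] := bijective_inverse bij1.
exists N1, N2; split=> //; exists (f2 \o g); apply: bij_comp => //.
exact: (Bijective gK fK).
Qed.

(** R/I is identified with S/M, so an integer lying in M lies in I.  Since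
    M = I + Sa, S = R + M and Ma lies in I, also S = R + Ra modulo I. *)
Lemma conductor_ramified : ramified_ideal I ->
  ramified_condition I /\ ramified_extension R.
Proof.
move=> [M0 rI]; have [maxM0 _ MM0 IM0 genM0] := rI.
pose M := pack_ideal maxM0.1.
have [IM nMI] : {subset I <= M} /\ ~ {subset M <= I} := IM0.
have RMI := conductor_contraction IM.
have RM := conductor_add_ideal nMI.
split.
  exists M; split=> //; apply/eq_characteristicP => n.
  rewrite -(rmorph_nat (\pi_{ideal_quot M})) -(rmorph_nat (\pi_{ideal_quot I})) !pi_eq0.
  apply/idP/idP => [h|]; last exact: IM.
  by apply: RMI => //; exact: rpred_nat.
exists I, M; split=> //; last exact: conductor_canonical_isomorphism.
have [f fE] := @induced_map_exists _ R I I (fun=> id).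
exists f; split=> //.
have [a Ma nIa] := subset_witness nMI.
have gen s : exists r t : subring_type R, s - (val r + val t * a) \in I.
  have [r Rr Ms] := RM s.
  have : s - r \in add_principal I a by rewrite -(genM0 a Ma nIa).
  case/add_principalP=> i Ii [u e]; have [t Rt Mt] := RM u.
  exists (SubringElt Rr), (SubringElt Rt) => /=.
  have -> : s - (r + t * a) = i + (u - t) * a.
    by rewrite opprD addrA e; ring.
  rewrite rpredD //; apply: MM0; apply/asboolP; exists [:: (u - t, a)].
    by move=> p; rewrite inE => /eqP ->.
  by rewrite big_seq1.
have indep (r t : S) : r \in R -> t \in R -> r + t * a \in I -> r \in I /\ t \in I.
  move=> Rr Rt h; have Ir : r \in I.
    apply: RMI => //; rewrite -(addrK (t * a) r) rpredB //; first exact: IM.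
    by rewrite idealMr.
  split=> //; apply: contraT => /(conductor_inverse Rt)[u Ru Iu].
  case/negP: nIa; have -> : a = a * (1 - u * t) + u * (r + t * a) - u * r by ring.
  by rewrite rpredB ?rpredD ?idealMr.
pose b (i : 'I_2) : {ideal_quot I} := if i == 0 then 1 else \pi a.
have sumE (c : {ffun 'I_2 -> {ideal_quot contraction_ideal R I}}) :
    \sum_(i < 2) f (c i) * b i = f (c 0) + f (c 1) * \pi a.
  by rewrite big_ord_recl big_ord1 /b /= mulr1; congr (_ + f (c _) * _); apply: val_inj.
exists b => y; have [s ->] := pi_surj y; have [r [t e]] := gen s.
pose piR := \pi_{ideal_quot contraction_ideal R I}.
exists [ffun i : 'I_2 => if i == 0 then piR r else piR t]; split.
  rewrite sumE !ffunE /= !fE -rmorphM -rmorphD; exact/pi_eqP.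
move=> c; rewrite sumE; have [r' e0] := pi_surj (c 0); have [t' e1] := pi_surj (c 1).
rewrite e0 e1 !fE -rmorphM -rmorphD => /pi_eqP e'.
have [|||Ir It] := @indep (val r' - val r) (val t' - val t).
- by apply: rpredB; exact: valP.
- by apply: rpredB; exact: valP.
- have -> : val r' - val r + (val t' - val t) * a =
    (s - (val r + val t * a)) - (s - (val r' + val t' * a)) by ring.
  exact: rpredB.
apply/ffunP => i; rewrite ffunE; case: (unliftP 0 i) => [j|] ->.
  have -> : lift 0 j = 1 by rewrite ord1; apply: val_inj.
  by rewrite e1 /=; apply/esym/pi_eqP.
by rewrite e0 /=; apply/esym/pi_eqP.
Qed.

End ConductorType.

(** * From a condition to an extension: inert and decomposed ideals *)

Definition adjoin_eval (S : comNzRingType) (R : subringClosed S) (x : S) :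
  {rmorphism {poly subring_type R} -> S} := horner_eval x \o map_poly (incl R).

Definition adjoin (S : comNzRingType) (R : subringClosed S) (x : S) :
  subringClosed S := rmorph_image (adjoin_eval R x).

Lemma adjoin_eval_horner (S : comNzRingType) (R : subringClosed S) x p :
  adjoin_eval R x p = (map_poly (incl R) p).[x].
Proof. by []. Qed.

Lemma adjoin_evalC (S : comNzRingType) (R : subringClosed S) x c :
  adjoin_eval R x c%:P = val c.
Proof. by rewrite adjoin_eval_horner map_polyC hornerC. Qed.

Lemma adjoin_evalX (S : comNzRingType) (R : subringClosed S) x :
  adjoin_eval R x 'X = x.
Proof. by rewrite adjoin_eval_horner map_polyX hornerX. Qed.

Lemma adjoin_evalE (S : comNzRingType) (R : subringClosed S) x n (p : {poly subring_type R}) :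
  (size p <= n)%N -> adjoin_eval R x p = \sum_(i < n) val p`_i * x ^+ i.
Proof.
move=> sp; rewrite adjoin_eval_horner (@horner_coef_wide _ n).
  by apply: eq_bigr => i _; rewrite coef_map.
exact: leq_trans (size_poly _ _) sp.
Qed.

Lemma sub_adjoin (S : comNzRingType) (R : subringClosed S) x : {subset R <= adjoin R x}.
Proof.
by move=> r Rr; apply/rmorph_imageP; exists (SubringElt Rr)%:P; rewrite adjoin_evalC.
Qed.

Lemma mem_adjoin (S : comNzRingType) (R : subringClosed S) x : x \in adjoin R x.
Proof. by apply/rmorph_imageP; exists 'X; rewrite adjoin_evalX. Qed.

(** Every polynomial in y equals its remainder modulo d at y, hence is a
    combination of the powers y^i with i < size d. *)
Lemma finite_extension_integral (S : comNzRingType) (R : subringClosed S) y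
    (d : {poly subring_type R}) :
  d \is monic -> adjoin_eval R y d = 0 -> (forall s, s \in adjoin R y) ->
  finite_extension R.
Proof.
move=> dm dy gen; apply: (@finite_extensionI _ _ (size d) (fun i => y ^+ i)) => s.
have /rmorph_imageP[p ->] := gen s.
pose r := Pdiv.Ring.rmodp p d.
have -> : adjoin_eval R y p = adjoin_eval R y r.
  rewrite {1}(Pdiv.RingMonic.rdivp_eq dm p).
  by rewrite rmorphD rmorphM [adjoin_eval R y d]dy mulr0 add0r.
exists (fun i => val r`_i); first by move=> i; exact: valP.
by apply: adjoin_evalE; apply/ltnW; rewrite Pdiv.Ring.ltn_rmodpN0 ?monic_neq0.
Qed.

(** Lifts of generators of B span A up to the kernel of f, which lies in R
    and is covered by the generator 1. *)
Lemma finite_extension_surj (A B : comNzRingType) (f : {rmorphism A -> B})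
  (R : subringClosed A) (K : subringClosed B) :
  (forall y, exists x, y = f x) -> (forall x, (f x \in K) = (x \in R)) ->
  finite_extension K -> finite_extension R.
Proof.
move=> fS RK [n [g gen]]; have [h hE] := choice (fun i => fS (g i)).
apply: (@finite_extensionI _ _ n.+1 (fun i => if unlift 0 i is Some j then h j else 1)) => s.
have [c sE] := gen (f s).
have [d dE] := choice (fun i => fS (val (c i))).
pose r := s - \sum_(i < n) d i * h i.
have Rr : r \in R.
  rewrite -RK rmorphB rmorph_sum sE (_ : _ - _ = 0) ?rpred0 //; apply/eqP.
  rewrite subr_eq0; apply/eqP/eq_bigr => i _.
  by rewrite rmorphM /= -dE -hE.
exists (fun i => if unlift 0 i is Some j then d j else r).
  by move=> i; case: unlift => // j; rewrite -RK -dE; exact: valP.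
rewrite big_ord_recl unlift_none mulr1.
rewrite (eq_bigr (fun i => d i * h i)) ?subrK // => i _.
by rewrite !liftK.
Qed.

(** For x outside K, minimality gives K[x] = L, so y = 1/x is a polynomial
    p(x) of size n.  Multiplying by y^(n-1) gives
    y^n = p_0 y^(n-1) + ... + p_(n-1), so y is integral.  As K is a field, y
    is outside K too, and L = K[y] is finite over K. *)
Lemma minimal_subfield_finite (L : comNzRingType) (K : subringClosed L) :
  is_field L -> is_field (subring_type K) -> minimal_extension K -> finite_extension K.
Proof.
move=> fL fK minK; have [[_ nLK] _] := minK.
have [x _ nKx] := subset_witness nLK.
have adjT z : z \notin K -> forall s, s \in adjoin K z.
  move=> nKz; apply: minimal_extension_above minK (@sub_adjoin _ _ _) _.
  by move=> h; case/negP: nKz; apply: h; exact: mem_adjoin.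
have x0 : x != 0 by apply: contra nKx => /eqP ->; exact: rpred0.
have [y yx] := fL x x0.
have y0 : y != 0 by apply: contra_eq_neq yx => ->; rewrite mul0r eq_sym oner_neq0.
have nKy : y \notin K.
  apply/negP => Ky; case/negP: nKx.
  have [|z zy] := fK (SubringElt Ky); first by rewrite -val_eqE.
  have {}zy : val z * y = 1 by move/(congr1 val): zy.
  have -> : x = val z by rewrite -[LHS]mul1r -zy -mulrA yx mulr1.
  exact: valP.
have /rmorph_imageP[p yp] := adjT x nKx y.
have {}yp := etrans yp (adjoin_evalE _ (leqnn (size p))).
set n := size p in yp.
have n0 : (0 < n)%N.
  by rewrite lt0n; apply: contra_neq y0 => n0; rewrite yp n0 big_ord0.
(* The coefficients of p in reverse order, which turns y = p(x) into
   y^n = q(y). *)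
pose q : {poly subring_type K} := \poly_(j < n) p`_(n.-1 - j).
have sq : (size q <= n)%N by exact: size_poly.
apply: (@finite_extension_integral _ _ y ('X^n - q)); last exact: adjT.
  by rewrite monicE lead_coefDl ?lead_coefXn // size_polyN size_polyXn.
rewrite rmorphB rmorphXn adjoin_evalX (adjoin_evalE _ sq).
apply/eqP; rewrite subr_eq0 -[in y ^+ n](prednK n0) exprS {1}yp mulr_suml.
rewrite (reindex_inj rev_ord_inj) /=; apply/eqP/eq_bigr => i _.
have -> : q`_i = p`_(n.-1 - i) by rewrite coef_poly ltn_ord.
rewrite -mulrA; congr (val p`_ _ * _); first by lia.
have -> : n.-1 = (n - i.+1 + i)%N.
  by have := ltn_ord i; lia.
by rewrite exprD mulrA -exprMn [x * y]mulrC yx expr1n mul1r.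
Qed.

(** R is the preimage of the maximal subfield K.  An element of the conductor
    outside I would be invertible modulo I and would put all of S in R. *)
Lemma inert_condition_subring (S : comNzRingType) (I : idealr S) : inert_condition I ->
  exists R : subringClosed S, I =i conductor R /\ minimal_finite_extension R.
Proof.
move=> [maxI [K [/maximal_subringE minK fK]]].
pose R := preimage_subring (\pi_{ideal_quot I} : {rmorphism S -> {ideal_quot I}}) K.
have KR x : (\pi x \in K) = (x \in R) by [].
have minR : minimal_extension R by apply/(minimal_extension_surj (@pi_surj _ I) KR).
have IR : {subset I <= R}.
  by move=> x Ix; rewrite -KR; move: Ix; rewrite -pi_eq0 => /eqP ->; exact: rpred0.
exists R; split.
  apply: conductor_eq => // r Rr nIr.
  apply: contrapT => h; have [[_ nSR] _] := minR; apply: nSR => s _.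
  have [invI _] := maximal_idealP I; have [y Iy] := invI maxI r nIr.
  have Rry : r * (y * s) \in R by apply: contrapT => /negP nR; apply: h; exists (y * s).
  have -> : s = s * (1 - y * r) + r * (y * s) by ring.
  by rewrite rpredD // IR // idealMr.
split=> //; apply: (finite_extension_surj (@pi_surj _ I) KR).
exact: minimal_subfield_finite (maximal_quotient_is_field maxI) fK minK.
Qed.

(** In the decomposed and ramified cases S/R is a line over the field R/I, so
    any element outside R generates S over R together with 1; this gives
    minimality and finiteness at once. *)
Lemma minimal_finite_extension_spanned (S : comNzRingType) (R : subringClosed S) a :
  a \notin R ->
  (forall t s, t \notin R -> exists2 r, r \in R & exists2 u, u \in R & s = r + u * t) ->
  minimal_finite_extension R.
Proof.
move=> nRa span; split; last by apply: (@finite_extension_pair _ _ a) => s; exact: span.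
split; first by split=> // h; case/negP: nRa; exact: h.
move=> [T [[RT TR] [_ nT]]]; apply: TR => t Tt; apply: contraT => nRt.
case: nT => s _; have [r Rr [u Ru ->]] := span t s nRt.
by rewrite rpredD ?rpredM //; exact: RT.
Qed.

Lemma equalizer_closed (A B : comNzRingType) (f g : {rmorphism A -> B}) :
  GRing.subring_closed [pred x | f x == g x].
Proof.
split; first by rewrite inE !rmorph1.
- by move=> x y; rewrite !inE !rmorphB => /eqP -> /eqP ->.
- by move=> x y; rewrite !inE !rmorphM => /eqP -> /eqP ->.
Qed.

Lemma maximal_ideals_comaximal (S : comNzRingType) (M N : idealr S) :
  maximal_ideal M -> maximal_ideal N -> ~ M =i N ->
  exists e, e \in M /\ 1 - e \in N.
Proof.
move=> maxM maxN ne; have [|x Mx nNx] := @subset_witness _ M N.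
  by move=> MN; apply: ne => x; apply/esym/(maximal_sub_eq maxM).
have [invN _] := maximal_idealP N; have [y Ny] := invN maxN x nNx.
by exists (y * x); rewrite idealMr.
Qed.

(** R consists of the elements whose residues in S/M and S/N correspond under
    the isomorphism f.  To write s = r + u t with t outside R, note that for u
    in R the difference s - u t lies in R as soon as the residue of u in S/N is
    the quotient of s_N - f(s_M) by t_N - f(t_M). *)
Lemma decomposed_condition_subring (S : comNzRingType) (I : idealr S) : decomposed_condition I ->
  exists R : subringClosed S, I =i conductor R /\ minimal_finite_extension R.
Proof.
move=> [M [N [[maxM maxN ne IE] [f bf]]]].
pose pM : {rmorphism S -> {ideal_quot M}} := \pi_{ideal_quot M}.
pose pN : {rmorphism S -> {ideal_quot N}} := \pi_{ideal_quot N}.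
pose R := pack_subring (equalizer_closed (f \o pM) pN).
have RE x : (x \in R) = (f (pM x) == pN x) by [].
have [e [Me Ne]] := maximal_ideals_comaximal maxM maxN ne.
have pM0 x : (pM x == 0) = (x \in M) := pi_eq0 M x.
have pN0 x : (pN x == 0) = (x \in N) := pi_eq0 N x.
have pMe : pM e = 0 by apply/eqP; rewrite pM0.
have pNe : pN e = 1 by rewrite -(rmorph1 pN); apply/esym/pi_eqP.
(* By the Chinese remainder theorem R maps onto S/N. *)
have lift_diag rho : exists2 u, u \in R & pN u = rho.
  have [g fK gK] := bf; have [v ->] : exists v, rho = pN v := pi_surj rho.
  have [u gu] : exists u, g (pN v) = pM u := pi_surj _.
  have uN : pN (u * (1 - e) + v * e) = pN v.
    by rewrite rmorphD !rmorphM rmorphB rmorph1 pNe subrr mulr0 add0r mulr1.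
  exists (u * (1 - e) + v * e) => //; rewrite RE uN.
  by rewrite rmorphD !rmorphM rmorphB rmorph1 pMe subr0 mulr0 addr0 mulr1 -gu gK.
have nRe : e \notin R by rewrite RE pMe pNe rmorph0 eq_sym oner_neq0.
exists R; split.
  apply: conductor_eq => [x|r].
    rewrite IE => /andP[Mx Nx]; rewrite RE.
    by move: Mx Nx; rewrite -pM0 -pN0 => /eqP -> /eqP ->; rewrite rmorph0.
  rewrite RE => /eqP Rr nIr; exists e; rewrite RE !rmorphM pMe pNe rmorph0 mulr0 mulr1.
  apply: contra nIr => /eqP r0; rewrite IE; apply/andP; split; last by rewrite -pN0 -r0.
  by rewrite -pM0 -(inj_eq (bij_inj bf)) rmorph0 Rr -r0.
apply: (minimal_finite_extension_spanned nRe) => t s; rewrite RE => nRt.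
have d0 : pN t - f (pM t) != 0 by rewrite subr_eq0 eq_sym.
have [w wd] := maximal_quotient_is_field maxN d0.
have [u Ru pu] := lift_diag ((pN s - f (pM s)) * w).
exists (s - u * t); last by exists u => //; rewrite subrK.
rewrite RE !rmorphB !rmorphM; move: Ru; rewrite RE => /eqP ->; rewrite pu.
rewrite -subr_eq0; apply/eqP.
have -> : forall a b c d : {ideal_quot N}, a - (b - a) * w * c - (b - (b - a) * w * d) =
  (b - a) * (w * (d - c) - 1) by move=> a b c d; ring.
by rewrite wd subrr mulr0.
Qed.

(** * Coefficient fields and ramified ideals *)

Definition meets_trivially (A : comNzRingType) (F m : {pred A}) : Prop :=
  forall x, x \in F -> x \in m -> x = 0.

Definition maximal_avoiding (A : comNzRingType) (m : {pred A}) (F : subringClosed A) : Prop :=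
  meets_trivially F m /\
  forall G : subringClosed A, {subset F <= G} -> meets_trivially G m -> {subset G <= F}.

(** Zorn's lemma for the subrings above F0 that meet m trivially. *)
Lemma maximal_avoiding_exists (A : comNzRingType) (m : {pred A}) (F0 : subringClosed A) :
  meets_trivially F0 m ->
  exists2 F : subringClosed A, {subset F0 <= F} & maximal_avoiding m F.
Proof.
move=> triv0.
pose ok (F : {pred A}) :=
  [/\ GRing.subring_closed F, {subset F0 <= F} & meets_trivially F m].
(* The order is carried by predicates and not by bundled subrings, which live
   in too large a universe for Zorn's lemma. *)
pose T := {F : A -> bool | ok F}.
pose carrier (s : T) : {pred A} := sval s.
pose le (s t : T) := `[< {subset carrier s <= carrier t} >].
have t0 : T := exist ok F0 (And3 (GRing.subringClosedP F0) (fun x h => h) triv0).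
have [||C totC|[F [cF F0F trivF]] maxF] := @classical_sets.ZL_preorder T t0 le.
- by move=> t; apply/asboolP.
- by move=> r s t /asboolP rs /asboolP st; apply/asboolP => x /rs /st.
- (* Joining F0 to the union also covers the empty chain. *)
  pose U : {pred A} := [pred x | `[< x \in F0 \/ exists2 s, C s & x \in carrier s >]].
  have subC s : C s -> {subset carrier s <= U}.
    by move=> Cs z sz; apply/asboolP; right; exists s.
  have sub0 : {subset F0 <= U} by move=> z ?; apply/asboolP; left.
  have UP x y : x \in U -> y \in U -> exists G : subringClosed A,
      [/\ x \in G, y \in G & {subset G <= U}].
    have packC s : C s -> exists2 G : subringClosed A, carrier s =i G & {subset F0 <= G}.
      by case: s => G [cG F0G tG] Cs; exists (pack_subring cG).
    move=> /asboolP[Fx|[s Cs sx]] /asboolP[Fy|[t Ct ty]].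
    + by exists F0.
    + have [G GE F0G] := packC t Ct.
      by exists G; split=> [||z]; rewrite -?GE //; [rewrite GE; exact: F0G | exact: subC].
    + have [G GE F0G] := packC s Cs.
      by exists G; split=> [||z]; rewrite -?GE //; [rewrite GE; exact: F0G | exact: subC].
    + have [[G GE _] [H HE _]] := (packC s Cs, packC t Ct).
      have [/asboolP st|/asboolP ts] := totC s t Cs Ct.
        exists H; rewrite -!HE; split=> //; first exact: st.
        by move=> z; rewrite -HE; exact: subC.
      exists G; rewrite -!GE; split=> //; first exact: ts.
      by move=> z; rewrite -GE; exact: subC.
  have okU : ok U.
    split=> //; last first.
      move=> z /asboolP[|[s Cs sz]]; first exact: triv0.
      by case: (s) sz => G [cG F0G tG]; exact: tG.
    split; first by apply: sub0; exact: rpred1.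
    + by move=> x y Ux Uy; have [G [Gx Gy]] := UP x y Ux Uy; apply; exact: rpredB.
    + by move=> x y Ux Uy; have [G [Gx Gy]] := UP x y Ux Uy; apply; exact: rpredM.
  exists (exist ok U okU) => s Cs.
  by apply/asboolP; exact: subC.
exists (pack_subring cF) => //; split=> // G FG trivG.
have F0G : {subset F0 <= G} by move=> x /F0F /FG.
have okG : ok G by split=> //; exact: GRing.subringClosedP.
have /asboolP := maxF (exist ok G okG) (asboolT FG).
exact.
Qed.

Lemma horner_add_sq0 (A : comNzRingType) (p : {poly A}) (x y : A) :
  y * y = 0 -> p.[x + y] = p.[x] + p^`().[x] * y.
Proof.
move=> yy; elim/poly_ind: p => [|p c IH]; first by rewrite deriv0 !horner0 mul0r addr0.
rewrite derivD derivM derivX derivC !hornerE IH.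
set P := p.[x]; set Q := p^`().[x].
transitivity (P * x + c + (P + Q * x) * y + Q * (y * y)); first by ring.
by rewrite yy; ring.
Qed.

Section CoefficientField.
Variables (A : comNzRingType) (m : idealr A).
Hypothesis mm : forall x y, x \in m -> y \in m -> x * y = 0.
Hypothesis unitA : forall x, x \notin m -> exists y, y * x = 1.

Lemma adjoin_eval_congr (F : subringClosed A) (x y : A) q : y - x \in m ->
  adjoin_eval F y q - adjoin_eval F x q \in m.
Proof.
move=> yx; rewrite !adjoin_eval_horner -(subrK x y) [_ - x + x]addrC.
by rewrite (horner_add_sq0 _ _ (mm yx yx)) addrAC subrr add0r idealMr.
Qed.

(** The hypothesis says that F[x] meets m trivially, so maximality of F
    applies to it. *)
Lemma maximal_avoiding_mem (F : subringClosed A) x : maximal_avoiding m F ->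
  (forall q, adjoin_eval F x q \in m -> adjoin_eval F x q = 0) -> x \in F.
Proof.
move=> [_ maxF] h; apply: (maxF (adjoin F x)); [exact: sub_adjoin| |exact: mem_adjoin].
by move=> _ /rmorph_imageP[q ->]; exact: h.
Qed.

(** Let v be the inverse of u in A.  A value q(v) in m becomes, after
    multiplication by a power of the unit u, an element of F lying in m, hence
    zero; so v can be adjoined to F. *)
Lemma maximal_avoiding_field (F : subringClosed A) u : maximal_avoiding m F ->
  u \in F -> u != 0 -> exists2 v, v \in F & v * u = 1.
Proof.
move=> maxF Fu u0; have [|v vu] := @unitA u.
  by apply: contra u0 => mu; apply/eqP; exact: maxF.1.
exists v => //; apply: maximal_avoiding_mem => // q mq.
set n := size q.
have E : v ^+ n * (u ^+ n * adjoin_eval F v q) = adjoin_eval F v q.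
  by rewrite mulrA -exprMn vu expr1n mul1r.
rewrite -E; suff -> : u ^+ n * adjoin_eval F v q = 0 by rewrite mulr0.
apply: maxF.1; last by rewrite idealMr.
rewrite (adjoin_evalE _ (leqnn n)) mulr_sumr; apply: rpred_sum => i _.
have -> : u ^+ n = u ^+ (n - i) * u ^+ i by rewrite -exprD subnK // ltnW.
rewrite mulrCA -mulrA -exprMn [u * v]mulrC vu expr1n mulr1 rpredM ?rpredX //.
exact: valP.
Qed.

(** A maximal F maps onto the residue field A/m.  Take g monic over F of least
    degree with g(x) in m.  Whenever x' is congruent to x modulo m and is a
    root of a monic h with deg h <= deg g, division by h shows that F[x']
    meets m trivially, so that x' lies in F.  If g'(x) is outside m, Newton's
    step x' = x - g(x)/g'(x) reaches a root of g, because m^2 = 0.  Otherwise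
    g' = 0 by minimality, the degree of g vanishes in A, and the hypothesis on
    powers gives h = X^k - x^k. *)
Lemma maximal_avoiding_surj (F : subringClosed A) : maximal_avoiding m F ->
  (forall n, (0 < n)%N -> n%:R \in m ->
    exists k, [/\ (0 < k)%N, (k <= n)%N & forall x, x ^+ k \in F]) ->
  forall x, exists2 r, r \in F & x - r \in m.
Proof.
move=> maxF powF x.
have [Fx|nFx] := boolP (x \in F); first by exists x; rewrite ?subrr ?rpred0.
pose bad n := `[< exists q : {poly subring_type F},
  [/\ q != 0, adjoin_eval F x q \in m & size q = n] >].
(* Otherwise F[x] would meet m trivially and x would lie in F. *)
have ex_bad : exists n, bad n.
  apply: contrapT => h; case/negP: nFx; apply: maximal_avoiding_mem => // q mq.
  have [->|q0] := eqVneq q 0; first exact: rmorph0.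
  by case: h; exists (size q); apply/asboolP; exists q.
case: (ex_minnP ex_bad) => n /asboolP[g0 [g0nz mg0 sg0]] minn.
have lead0 : lead_coef g0 != 0 by rewrite lead_coef_eq0.
have [c cl] : exists c : subring_type F, c * lead_coef g0 = 1.
  have [|v Fv vl] := maximal_avoiding_field maxF (valP (lead_coef g0)) _.
    by apply: contra lead0 => /eqP e; apply/eqP/val_inj.
  by exists (SubringElt Fv); apply: val_inj.
have minr (r : {poly subring_type F}) : (size r < n)%N -> adjoin_eval F x r \in m -> r = 0.
  move=> sr mr; apply/eqP; apply: contraTT sr => r0; rewrite -leqNgt; apply: minn.
  by apply/asboolP; exists r.
pose g := c *: g0.
have gn : g`_n.-1 = 1 by rewrite coefZ -sg0.
have sg : size g = n.
  apply/eqP; rewrite eqn_leq -{1}sg0 size_scale_leq /= leqNgt; apply/negP => h.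
  have n0 : (0 < n)%N by rewrite -sg0 size_poly_gt0.
  move/eqP: gn; rewrite nth_default; first by rewrite eq_sym oner_eq0.
  by rewrite -ltnS (prednK n0).
have gm : g \is monic by rewrite monicE /lead_coef sg gn.
have mg : adjoin_eval F x g \in m.
  by rewrite /g -mul_polyC rmorphM idealMr.
(* The remainder of q modulo h takes a value in m at x' and therefore at x, so
   it vanishes by minimality of the degree of g. *)
have key x' (h : {poly subring_type F}) : x' - x \in m -> h \is monic ->
    (size h <= n)%N -> adjoin_eval F x' h = 0 -> x' \in F.
  move=> xx' hm sh hx'; apply: maximal_avoiding_mem => // q.
  pose r := Pdiv.Ring.rmodp q h.
  have -> : adjoin_eval F x' q = adjoin_eval F x' r.
    rewrite {1}(Pdiv.RingMonic.rdivp_eq hm q).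
    by rewrite rmorphD rmorphM [adjoin_eval F x' h]hx' mulr0 add0r.
  move=> mr; rewrite (minr r) ?rmorph0 //.
    by apply: leq_trans sh; rewrite Pdiv.Ring.ltn_rmodpN0 ?monic_neq0.
  by rewrite -[adjoin_eval F x r](subKr (adjoin_eval F x' r)) rpredB // adjoin_eval_congr.
have [mD|nmD] := boolP (adjoin_eval F x g^`() \in m); last first.
  have [v vD] := unitA nmD; pose y := - (v * adjoin_eval F x g).
  have my : y \in m by rewrite rpredN idealMr.
  exists (x + y); last by rewrite opprD addrA subrr add0r rpredN.
  apply: (key _ g); rewrite ?sg //; first by rewrite addrAC subrr add0r.
  rewrite adjoin_eval_horner (horner_add_sq0 _ _ (mm my my)) deriv_map -!adjoin_eval_horner.
  by rewrite /y mulrN mulrA [_ * v]mulrC vD mul1r subrr.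
exists x; last by rewrite subrr rpred0.
have g'0 : g^`() = 0 by apply: minr => //; rewrite -sg lt_size_deriv // monic_neq0.
have n1 : (1 < n)%N.
  rewrite ltnNge; apply/negP => n1; move: mg.
  have : (size g <= 1)%N by rewrite sg.
  move=> /size1_polyC e; move: gn; have -> : n.-1 = 0%N by move: n1; lia.
  by move=> g0E; rewrite e g0E rmorph1 idealr1.
have d0 : n.-1%:R = 0 :> subring_type F.
  have : g^`()`_n.-2 = 0 by rewrite g'0 coef0.
  by rewrite coef_deriv (_ : n.-2.+1 = n.-1) ?gn //; move: n1; lia.
have [||k [k0 kn xk]] := powF n.-1.
- by move: n1; lia.
- by rewrite -(rmorph_nat (incl F)) d0 rmorph0 rpred0.
apply: (key x ('X^k - (SubringElt (xk x))%:P)).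
- by rewrite subrr rpred0.
- by rewrite monicXnsubC.
- by rewrite size_XnsubC //; move: kn n1; lia.
- by rewrite rmorphB rmorphXn adjoin_evalX adjoin_evalC subrr.
Qed.

(** If no positive integer lies in m, start from the image of the integers.
    Otherwise the least such integer p is prime and is zero in A, and one
    starts from the subring of p-th powers: it meets m trivially since x^p in
    m forces x in m and then x^p = 0, and it supplies the powers needed when
    the derivative of a minimal polynomial vanishes. *)
Lemma coefficient_field_exists : (forall n, n%:R \in m -> n%:R = 0 :> A) ->
  exists2 F : subringClosed A, meets_trivially F m &
    forall x, exists2 r, r \in F & x - r \in m.
Proof.
move=> charA.
have [ex|nex] := pselect (exists n, (0 < n)%N && (n%:R \in m)); last first.
  have [z /rmorph_imageP[n ->] mn|F _ maxF] :=
    @maximal_avoiding_exists A m (rmorph_image (intmul 1 : {rmorphism int -> A})).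
    case: n mn => n mn; first exact: charA.
    by apply/eqP; rewrite -oppr_eq0 opprK charA // -rpredN.
  exists F; first exact: maxF.1.
  by apply: maximal_avoiding_surj => // n n0 mn; case: nex; exists n; rewrite n0.
case: (ex_minnP ex) => p /andP[p0 mp] minp.
have p_pr : prime p.
  apply/primeP; split.
    by case: p p0 mp {minp} => [//|[|//]] _; rewrite idealr1.
  move=> d /dvdnP[k e]; have [/andP[k0 d0]] : (0 < k)%N && (0 < d)%N.
    by move: p0; rewrite e muln_gt0.
  have [md|/unitA[v vd]] := boolP (d%:R \in m).
    have := minp d; rewrite d0 md e => /(_ isT) h.
    apply/orP; right; rewrite eqn_leq h andbT; nia.
  have mk : k%:R \in m.
    have -> : k%:R = v * p%:R by rewrite e natrM mulrCA vd mulr1.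
    by rewrite idealMr.
  have := minp k; rewrite k0 mk e => /(_ isT) h; apply/orP; left; rewrite eqn_leq d0 andbT; nia.
have chp : p \in [pchar A] by rewrite inE p_pr charA ?eqxx.
pose phi : {rmorphism A -> A} := pFrobenius_aut chp.
have phiE x : phi x = x ^+ p := pFrobenius_autE chp x.
have [z /rmorph_imageP[x ->]|F F0F maxF] :=
  @maximal_avoiding_exists A m (rmorph_image phi).
  rewrite phiE => mx.
  have mx1 : x \in m.
    apply: contraT => /unitA[y yx]; have : 1 \in m.
      by rewrite -(expr1n _ p) -yx exprMn idealMr.
    by rewrite idealr1.
  by rewrite -(subnKC (prime_gt1 p_pr)) exprD expr2 (mm mx1 mx1) mul0r.
exists F; first exact: maxF.1.
apply: maximal_avoiding_surj => // n n0 mn; exists p; split=> //.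
  by apply: minp; rewrite n0.
by move=> x; apply: F0F; apply/rmorph_imageP; exists x; rewrite phiE.
Qed.

End CoefficientField.

Lemma quotient_ideal_closed (S : comNzRingType) (I M : idealr S) : {subset I <= M} ->
  idealr_closed [pred q : {ideal_quot I} | repr q \in M] /\
  forall x, (repr (\pi_{ideal_quot I} x) \in M) = (x \in M).
Proof.
move=> IM; have piM x : (repr (\pi_{ideal_quot I} x) \in M) = (x \in M).
  have h : x - repr (\pi_{ideal_quot I} x) \in M by apply/IM/pi_eqP; rewrite reprK.
  by rewrite -{2}(subrK (repr (\pi_{ideal_quot I} x)) x) rpredDl.
split=> //; split.
- by rewrite inE -(rmorph0 (\pi_{ideal_quot I})) piM rpred0.
- by rewrite inE -(rmorph1 (\pi_{ideal_quot I})) piM idealr1.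
- move=> a u v; have [x ->] := pi_surj a; have [y ->] := pi_surj u.
  have [z ->] := pi_surj v.
  by rewrite !inE -rmorphM -rmorphD !piM => My Mz; rewrite rpredD // idealMr.
Qed.

(** R is the preimage of a coefficient field of S/I, so that R and M meet in I
    and R + M = S.  If t is outside R, its component b in M is outside I, so
    M = I + Sb = I + Rb modulo M^2, and S = R + Rt. *)
Lemma ramified_condition_subring (S : comNzRingType) (I : idealr S) : ramified_condition I ->
  exists R : subringClosed S, I =i conductor R /\ minimal_finite_extension R.
Proof.
move=> [M [[maxM [[_ primI] radI] MM [IM nMI] genM] /eq_characteristicP charE]].
have {}MM x y : x \in M -> y \in M -> x * y \in I.
  move=> Mx My; apply: MM; apply/asboolP; exists [:: (x, y)]; last by rewrite big_seq1.
  by move=> p; rewrite inE => /eqP ->.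
have [mc mE] := quotient_ideal_closed IM; pose m := pack_ideal mc.
pose pI : {rmorphism S -> {ideal_quot I}} := \pi_{ideal_quot I}.
have pI0 x : (pI x == 0) = (x \in I) := pi_eq0 I x.
have pIS y : exists x, y = pI x := pi_surj y.
have {}mE x : (pI x \in m) = (x \in M) := mE x.
have [u v mu mv|u nmu|n mn|F Fm FA] := @coefficient_field_exists _ m.
- move: mu mv; have [x ->] := pIS u; have [y ->] := pIS v; rewrite !mE => Mx My.
  by apply/eqP; rewrite -rmorphM pI0 MM.
- move: nmu; have [x ->] := pIS u; rewrite mE => nMx.
  have [invM _] := maximal_idealP M; have [y My] := invM maxM x nMx.
  exists (pI (y * (2%:R - y * x))); rewrite -rmorphM -(rmorph1 pI); apply/eqP.
  rewrite eq_sym -subr_eq0 -rmorphB pI0.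
  have -> : 1 - y * (2%:R - y * x) * x = (1 - y * x) * (1 - y * x) by ring.
  exact: MM.
- apply/eqP; rewrite -charE -(rmorph_nat (\pi_{ideal_quot M})) pi_eq0 -mE.
  by rewrite rmorph_nat.
pose R := preimage_subring pI F.
have RE x : (x \in R) = (pI x \in F) by [].
have IR : {subset I <= R}.
  by move=> x; rewrite -pI0 RE => /eqP ->; exact: rpred0.
have RMI x : x \in R -> x \in M -> x \in I.
  by move=> Rx; rewrite -mE -pI0 => /(Fm _ Rx) ->.
have RM s : exists2 r, r \in R & s - r \in M.
  have [q] := FA (pI s); have [r ->] := pIS q => Fr.
  by rewrite -rmorphB mE; exists r.
have nRM a : a \in M -> a \notin I -> a \notin R.
  by move=> Ma; apply: contra => Ra; exact: RMI.
have [a Ma nIa] := subset_witness nMI.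
exists R; split.
  apply: conductor_eq => // r Rr nIr; exists a; apply: nRM; first by rewrite idealMr.
  apply: contra nIr; rewrite mulrC => /primI[|[k Ik]]; first by rewrite (negbTE nIa).
  by apply: RMI => //; rewrite -radI; apply/asboolP; exists k.
apply: (@minimal_finite_extension_spanned _ _ a) => [|t s nRt]; first exact: nRM.
have [r0 Rr0 Mb] := RM t; set b := t - r0 in Mb.
have nIb : b \notin I.
  by apply: contra nRt => Ib; rewrite -(subrK r0 t) rpredD // IR.
have [r1 Rr1] := RM s; rewrite (genM b Mb nIb) => /add_principalP[i Ii [u e]].
have [r2 Rr2 Mu] := RM u.
exists (s - r2 * t); last by exists r2 => //; rewrite subrK.
have -> : s - r2 * t = r1 - r2 * r0 + (i + (u - r2) * b).
  have -> : i = s - r1 - u * b by rewrite e addrK.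
  by rewrite /b; ring.
by rewrite rpredD ?rpredB ?rpredM // IR // rpredD // MM.
Qed.

Theorem theorem4p15 (S : comNzRingType) (I : idealr S) (hI : quasi_maximal I) :
  ((exists R : subringClosed S,
      I =i conductor R /\ minimal_finite_extension R) <->
   [\/ inert_condition I, decomposed_condition I | ramified_condition I]) /\
  (forall R : subringClosed S,
     I =i conductor R -> minimal_finite_extension R ->
     [/\ inert_ideal I -> inert_extension R,
         decomposed_ideal I -> decomposed_extension R &
         ramified_ideal I -> ramified_extension R]).
Proof.
split=> [|R IR mR].
  split=> [[R [IR mR]]|[||]].
  - have [iI|dI|rI] := quasi_maximal_trichotomy hI.
    + by constructor 1; case: (conductor_inert IR mR iI).
    + by constructor 2; case: (conductor_decomposed IR mR dI).
    + by constructor 3; case: (conductor_ramified IR mR rI).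
  - exact: inert_condition_subring.
  - exact: decomposed_condition_subring.
  - exact: ramified_condition_subring.
split=> tI.
- by case: (conductor_inert IR mR tI).
- by case: (conductor_decomposed IR mR tI).
- by case: (conductor_ramified IR mR tI).
Qed.
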